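(* Let $X_\Sigma$ be a smooth complete toric variety over a valued field $K$, let $\mathcal F$ be a toric vector bundle on $X_\Sigma$, and let $\mathcal E=\operatorname{trop}(\mathcal F)$ be the tropicalization of $\mathcal F$ with respect to any realization $\mathcal G$ of a matroid for $\mathcal F$. Then $$h^0(\mathcal E)_{\mathbf u}=h^0(\mathcal F)_{\mathbf u}\ \text{ for all }\mathbf u\in M,\qquad\text{and thus}\qquad h^0(\mathcal E)=h^0(\mathcal F).$$
   Context: $N\cong\mathbb Z^n$, $M=\operatorname{Hom}(N,\mathbb Z)$; $\Sigma$ is a complete fan in $N\otimes\mathbb R$ with rays $\rho_1,\dots,\rho_s$, first lattice points $\mathbf v_i$ and torus-invariant divisors $D_i$. $K$ has valuation $\operatorname{val}:K\to\mathbb R\cup\{\infty\}$. A toric vector bundle $\mathcal F$ of rank $r$ on $X_\Sigma$ is described, by Klyachko, by decreasing filtrations $E^i(j)$ ($j\in\mathbb Z$, $1\le i\le s$) of the fibre $E\cong K^r$ over the identity of the torus, with $E^i(j)=E$ for $j\ll0$, $E^i(j)=0$ for $j\gg0$, such that for every $\sigma\in\Sigma$ there is a decomposition $E=\bigoplus_{\mathbf u\in M}E^\sigma_{\mathbf u}$ with $E^i(j)=\sum_{\mathbf u\cdot\mathbf v_i\ge j}E^\sigma_{\mathbf u}$ for $\rho_i\in\sigma$. Conventions: the torus $T$ acts on sections by $(t\cdot s)(x)=t(s(t^{-1}x))$, the subscript $\mathbf u$ denotes the $\mathbf u$-isotypical component, and on the chart $U_{\rho_i}$ evaluation at the identity of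 $T$ identifies $H^0(U_{\rho_i},\mathcal F)_{\mathbf u}$ with $E^i(\mathbf u\cdot\mathbf v_i)$; thus $\mathcal O(\sum a_iD_i)$ has $E^i(j)=K$ for $j\le a_i$ and $0$ for $j>a_i$. $h^0(\mathcal F)_{\mathbf u}=\dim_KH^0(X_\Sigma,\mathcal F)_{\mathbf u}$ and $h^0(\mathcal F)=\dim_KH^0(X_\Sigma,\mathcal F)$. Let $L'(\mathcal F)$ be the set of all intersections $\bigcap_iE^i(j_i)$ and $L(\mathcal F)$ the poset of all spans of subsets of $L'(\mathcal F)$. A realization of a matroid for $\mathcal F$ is a finite set $\mathcal G\subset E$ of nonzero pairwise non-proportional vectors spanning $E$ such that every $V\in L(\mathcal F)$ is spanned by $V\cap\mathcal G$ (so $V\mapsto V\cap\mathcal G$ identifies $L(\mathcal F)$ with a join-sublattice of the lattice of flats of the linear matroid of $\mathcal G$). The tropicalization $\operatorname{trop}(\mathcal F)$ of $(\mathcal F,\mathcal G)$ is the tropical toric vector bundle consisting of the valuated matroid $\mathcal M$ on $\mathcal G$ with $\nu(B)=\operatorname{val}(\det(B))$, whose underlying matroid $\underline{\mathcal M}$ is the linear matroid of $\mathcal G$, and the flats $E^i(j)\cap\mathcal G$. For a tropical toric vector bundle $\mathcal E$ with ground set $\mathcal G$ and flats $E^i(j)\subseteq\mathcal G$, and $\mathbf w\in\mathcal G$, let $(\mathbf d_{\mathbf w})_i=\max\{j:\mathbf w\in E^i(j)\}$ and $P_{\mathbf w}=\{\mathbf u\in M\otimes\mathbb R:\mathbf u\cdot\mathbf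 v_i\le(\mathbf d_{\mathbf w})_i\text{ for all }1\le i\le s\}$. Define $h^0(\mathcal E)_{\mathbf u}=\operatorname{rk}\big(\bigvee_{\mathbf w:\,\mathbf u\in P_{\mathbf w}}\mathbf w\big)$ for $\mathbf u\in M$ (rank in $\underline{\mathcal M}$ of the smallest flat containing these $\mathbf w$) and $h^0(\mathcal E)=\sum_{\mathbf u\in M}h^0(\mathcal E)_{\mathbf u}$. *)

(* Defs.v *)
From HB Require Import structures.
From mathcomp Require Import all_boot all_order all_algebra finmap perm.
From mathcomp Require Import all_classical reals constructive_ereal.

Set Implicit Arguments.
Unset Strict Implicit.
Unset Printing Implicit Defensive.

Import Order.TTheory GRing.Theory Num.Theory.

Local Open Scope ring_scope.

(** * Linear algebra in possibly infinite-dimensional spaces *)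

Definition lin_span (K : fieldType) (V : lmodType K) (A : set V) : set V :=
  [set x | exists l : seq (K * V),
     (forall p, p \in l -> A p.2) /\ x = \sum_(p <- l) p.1 *: p.2].

(* [W] (a linear subspace in all uses) is finite-dimensional, of dimension [d]. *)
Definition has_dim (K : fieldType) (V : lmodType K) (W : set V) (d : nat) : Prop :=
  exists b : 'I_d -> V,
    [/\ forall i, W (b i),
        forall c : 'I_d -> K, \sum_i c i *: b i = 0 -> forall i, c i = 0
      & forall x, W x -> exists c : 'I_d -> K, x = \sum_i c i *: b i].

(** * Fans in N = Z^n, with dual lattice M = Z^n *)

Definition dot (A : nzRingType) (n : nat) (u v : 'rV[A]_n) : A :=
  \sum_k u 0 k * v 0 k.

Definition real_pt (R : realType) (n : nat) (u : 'rV[int]_n) : 'rV[R]_n :=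
  map_mx intr u.

Definition cone_of (R : realType) (n s : nat) (v : 'I_s -> 'rV[int]_n)
    (sigma : {set 'I_s}) : set 'rV[R]_n :=
  [set x | exists c : 'I_s -> R, (forall i, 0 <= c i) /\
             x = \sum_(i in sigma) c i *: real_pt R (v i)].
Arguments cone_of R {n s} v sigma.

Definition is_face (R : realType) (n s : nat) (v : 'I_s -> 'rV[int]_n)
    (tau sigma : {set 'I_s}) : Prop :=
  exists m : 'rV[R]_n,
    (forall i, i \in sigma -> 0 <= dot m (real_pt R (v i))) /\
    tau = [set i in sigma | dot m (real_pt R (v i)) == 0].

(* A cone is recorded by the set of (indices of) its rays.  Since the zero cone
   [set0] belongs to the fan, [fan_meet] makes it a face of every cone, i.e. all
   the cones are strongly convex; applied to the cones [[set i]], it also shows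
   that the rays of the cone generated by [sigma] are exactly those indexed by
   [sigma], and that distinct indices give distinct rays. *)
Record fan (R : realType) (n s : nat) := Fan {
  ray : 'I_s -> 'rV[int]_n;
  cones : {set {set 'I_s}};
  ray_primitive : forall i (k : int) (w : 'rV[int]_n),
    ray i = k *: w -> `|k| = 1;
  fan_zero : finset.set0 \in cones;
  fan_ray : forall i, [set i]%SET \in cones;
  fan_face : forall sigma tau : {set 'I_s}, sigma \in cones ->
    is_face R ray tau sigma -> tau \in cones;
  fan_meet : forall sigma tau : {set 'I_s}, sigma \in cones -> tau \in cones ->
    is_face R ray (sigma :&: tau)%SET sigma /\
    (cone_of R ray sigma `&` cone_of R ray tau =
       cone_of R ray (sigma :&: tau)%SET)%classic }.

Definition complete_fan (R : realType) (n s : nat) (S : fan R n s) : Prop :=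
  forall x : 'rV[R]_n, exists2 sigma, sigma \in cones S & cone_of R (ray S) sigma x.

(* The first lattice points of the rays of each cone are part of a Z-basis of N
   (the rows of [A]). *)
Definition smooth_fan (R : realType) (n s : nat) (S : fan R n s) : Prop :=
  forall sigma, sigma \in cones S ->
    exists2 A : 'M[int]_n, A \in unitmx &
      forall i, i \in sigma -> exists k, ray S i = row k A.

(** * Toric vector bundles, in Klyachko's description *)

(* [D u] is the summand E^sigma_u; it is nonzero for finitely many u only. *)
Definition klyachko_splitting (K : fieldType) (R : realType) (n s r : nat)
    (S : fan R n s) (E : 'I_s -> int -> {vspace 'rV[K]_r})
    (sigma : {set 'I_s}) (D : 'rV[int]_n -> {vspace 'rV[K]_r}) : Prop :=
  exists U : {fset 'rV[int]_n},
    [/\ forall u, u \notin U -> D u = 0%VS,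
        directv (\sum_(u <- U) D u),
        (\sum_(u <- U) D u)%VS = fullv
      & forall i, i \in sigma -> forall j,
          E i j = (\sum_(u <- U | (j <= dot u (ray S i))%R) D u)%VS].

(* A bundle of rank [r]; its fibre over the identity of the torus is identified
   with K^r. *)
Record toric_bundle (K : fieldType) (R : realType) (n s r : nat)
    (S : fan R n s) := ToricBundle {
  filt : 'I_s -> int -> {vspace 'rV[K]_r};
  filt_decr : forall i j k, j <= k -> (filt i k <= filt i j)%VS;
  filt_full : forall i, exists j0, forall j, j <= j0 -> filt i j = fullv;
  filt_zero : forall i, exists j0, forall j, j0 <= j -> filt i j = 0%VS;
  filt_split : forall sigma, sigma \in cones S ->
    exists D, klyachko_splitting S filt sigma D }.

(* The torus action trivializes the bundle over the torus T, so that its sections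
   over T are the Laurent polynomials \sum_m s_m chi^m with coefficients s_m in
   the fibre E at the identity; they are represented by their coefficient
   functions m |-> s_m. *)
Definition lmono (K : fieldType) (n r : nat) (e : 'rV[K]_r) (m : 'rV[int]_n) :
    'rV[int]_n -> 'rV[K]_r :=
  fun m' => if m' == m then e else 0.

(* H^0(U_sigma, F), as a subspace of H^0(T, F).  Over U_sigma the bundle is the
   direct sum of the E^sigma_u (x) O(div chi^u), and chi^(-u) generates
   O(div chi^u): the sections are the K[U_sigma]-submodule of E[M] generated by
   the e chi^(-u) with e in E^sigma_u, where K[U_sigma] is spanned by the chi^m
   with m nonnegative on sigma.  This module does not depend on the splitting. *)
Definition chart_sections (K : fieldType) (R : realType) (n s r : nat)
    (S : fan R n s) (F : toric_bundle K r S) (sigma : {set 'I_s}) :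
    set ('rV[int]_n -> 'rV[K]_r) :=
  [set f | exists2 D, klyachko_splitting S (filt F) sigma D &
     lin_span [set g | exists (e : 'rV[K]_r) (m u : 'rV[int]_n),
        [/\ e \in D u, forall i, i \in sigma -> 0 <= dot m (ray S i)
          & g = lmono e (m - u)]] f].

(* Restriction to T is injective on sections, so that a global section is a
   section over T which extends to all the charts. *)
Definition H0 (K : fieldType) (R : realType) (n s r : nat)
    (S : fan R n s) (F : toric_bundle K r S) : set ('rV[int]_n -> 'rV[K]_r) :=
  [set f | forall sigma, sigma \in cones S -> chart_sections F sigma f].

(* The u-isotypical component.  As (t.f)(x) = f(t^-1 x) on functions on T, the
   monomial e chi^m has weight -m. *)
Definition H0_wt (K : fieldType) (R : realType) (n s r : nat)
    (S : fan R n s) (F : toric_bundle K r S) (u : 'rV[int]_n) :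
    set ('rV[int]_n -> 'rV[K]_r) :=
  [set f | H0 F f /\ forall m, m != - u -> f m = 0].

(** * Realizations of a matroid for a toric vector bundle *)

Definition Lprime (K : fieldType) (R : realType) (n s r : nat)
    (S : fan R n s) (F : toric_bundle K r S) (V : {vspace 'rV[K]_r}) : Prop :=
  exists j : 'I_s -> int, V = (\bigcap_i filt F i (j i))%VS.

(* L'(F) is finite, so that finite lists give the spans of all its subsets. *)
Definition Lspan (K : fieldType) (R : realType) (n s r : nat)
    (S : fan R n s) (F : toric_bundle K r S) (V : {vspace 'rV[K]_r}) : Prop :=
  exists l : seq {vspace 'rV[K]_r},
    (forall W, W \in l -> Lprime F W) /\ V = (\sum_(W <- l) W)%VS.

Record realization (K : fieldType) (R : realType) (n s r : nat)
    (S : fan R n s) (F : toric_bundle K r S) (G : {fset 'rV[K]_r}) : Prop :=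
  Realization {
    rlz_neq0 : 0 \notin G;
    rlz_simple : forall x y, x \in G -> y \in G -> x != y -> x \notin <[y]>%VS;
    rlz_span : <<G>>%VS = fullv;
    rlz_L : forall V, Lspan F V -> V = <<[seq w <- G | w \in V]>>%VS }.

(** * Valuated matroids and tropical toric vector bundles *)

Record valuation (K : fieldType) (R : realType) := Valuation {
  val_of :> K -> \bar R;
  val_ninfty : forall x, val_of x != -oo%E;
  val_infty : forall x, (val_of x == +oo%E) = (x == 0);
  val_mul : forall x y, val_of (x * y) = (val_of x + val_of y)%E;
  val_add : forall x y,
    (Order.min (val_of x) (val_of y) <= val_of (x + y))%E }.

(* [vm_val B] is finite exactly when [B] is a basis of the underlying matroid. *)
Record valuated_matroid (R : realType) (T : finType) := ValuatedMatroid {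
  vm_val : {set T} -> \bar R;
  vm_ninfty : forall B, vm_val B != -oo%E;
  vm_basis : exists B, vm_val B != +oo%E;
  vm_exchange : forall B B', vm_val B != +oo%E -> vm_val B' != +oo%E ->
    forall b, b \in (B :\: B')%SET -> exists2 b', b' \in (B' :\: B)%SET &
      (vm_val (b' |: B :\ b)%SET + vm_val (b |: B' :\ b')%SET
         <= vm_val B + vm_val B')%E }.

(* Rank, flats and closure in the underlying matroid. *)
Definition vm_rank (R : realType) (T : finType) (N : valuated_matroid R T)
    (A : {set T}) : nat :=
  \max_(B : {set T} | vm_val N B != +oo%E) #|(A :&: B)%SET|.

Definition vm_flat (R : realType) (T : finType) (N : valuated_matroid R T)
    (A : {set T}) : bool :=
  [forall x, (x \notin A) ==> (vm_rank N A < vm_rank N (x |: A)%SET)%N].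

Definition vm_closure (R : realType) (T : finType) (N : valuated_matroid R T)
    (A : {set T}) : {set T} :=
  (\bigcap_(C : {set T} | vm_flat N C && (A \subset C)) C)%SET.

(* The data of a tropical toric vector bundle that enter the definition of h^0;
   [s] is the number of rays. *)
Record trop_bundle (R : realType) (s : nat) (T : finType) := TropBundle {
  tb_matroid : valuated_matroid R T;
  tb_flat : 'I_s -> int -> {set T};
  tb_flatP : forall i j, vm_flat tb_matroid (tb_flat i j);
  tb_decr : forall i j k, j <= k -> tb_flat i k \subset tb_flat i j;
  tb_full : forall i, exists j0, forall j, j <= j0 -> tb_flat i j = [set: T]%SET;
  tb_empty : forall i, exists j0, forall j, j0 <= j -> tb_flat i j = finset.set0 }.

(* The maximum exists by [tb_full] and [tb_empty]. *)
Definition dvec (R : realType) (s : nat) (T : finType) (B : trop_bundle R s T)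
    (w : T) (i : 'I_s) : int :=
  xget 0 [set d | w \in tb_flat B i d /\ forall j, w \in tb_flat B i j -> j <= d].

Definition polytope (R : realType) (n s : nat) (S : fan R n s) (T : finType)
    (B : trop_bundle R s T) (w : T) : set 'rV[R]_n :=
  [set x | forall i, dot x (real_pt R (ray S i)) <= (dvec B w i)%:~R].

Definition trop_h0_wt (R : realType) (n s : nat) (S : fan R n s) (T : finType)
    (B : trop_bundle R s T) (u : 'rV[int]_n) : nat :=
  vm_rank (tb_matroid B)
    (vm_closure (tb_matroid B) [set w | real_pt R u \in polytope S B w]%SET).

(* As any sum over a set, this one is 0 by convention if infinitely many terms
   are nonzero. *)
Definition trop_h0 (R : realType) (n s : nat) (S : fan R n s) (T : finType)
    (B : trop_bundle R s T) : nat :=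
  \big[addn/0%N]_(u \in [set: 'rV[int]_n]) trop_h0_wt S B u.

(** * Tropicalization *)

(* Only used for #|B| = r; the order of the rows does not matter up to sign. *)
Definition det_of (K : fieldType) (r : nat) (G : {fset 'rV[K]_r}) (B : {set G}) : K :=
  \det (\matrix_(i < r) nth 0 [seq fsval w | w <- enum B] i).

Definition trop_val (K : fieldType) (R : realType) (v : valuation K R) (r : nat)
    (G : {fset 'rV[K]_r}) (B : {set G}) : \bar R :=
  if #|B| == r then v (det_of B) else +oo%E.

Definition trop_flat (K : fieldType) (R : realType) (n s r : nat)
    (S : fan R n s) (F : toric_bundle K r S) (G : {fset 'rV[K]_r})
    (i : 'I_s) (j : int) : {set G} :=
  [set w : G | fsval w \in filt F i j]%SET.

Section Val.
Context (K : fieldType) (R : realType) (v : valuation K R).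

Lemma valuation0 : v 0 = +oo%E.
Proof. by apply/eqP; rewrite val_infty. Qed.

Lemma valuation_fin x : x != 0 -> v x \is a fin_num.
Proof. by move=> x0; rewrite fin_numE val_ninfty val_infty x0. Qed.

Lemma valuation1 : v 1 = 0%E.
Proof.
have := val_mul v 1 1; rewrite mulr1.
have := valuation_fin (oner_neq0 K); case: (v 1) => // a _ [/eqP].
by rewrite -subr_eq subrr => /eqP <-.
Qed.

Lemma valuationN1 : v (-1) = 0%E.
Proof.
have := val_mul v (-1) (-1); rewrite mulrNN mulr1 valuation1.
have : (-1 : K) != 0 by rewrite oppr_eq0 oner_neq0.
move/valuation_fin; case: (v (-1)) => // a _ [] /eqP.
by rewrite eq_sym -mulr2n mulrn_eq0 /= => /eqP ->.
Qed.

Lemma valuation_sign (b : bool) x : v ((-1) ^+ b * x) = v x.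
Proof. by case: b; rewrite ?mul1r // expr1 val_mul valuationN1 add0e. Qed.

Lemma valuation_sum (I : finType) (f : I -> K) : \sum_i f i != 0 ->
  exists i, (v (f i) <= v (\sum_i f i)%R)%E.
Proof.
move=> S0; apply/existsP; apply: contraT; rewrite negb_exists => /forallP H.
set x := v (\sum_i f i)%R in H.
suff : (x < v (\sum_i f i)%R)%E by rewrite ltxx.
apply: (big_ind (fun y => (x < v y)%E)).
- by rewrite valuation0 ltey /x val_infty.
- by move=> a b xa xb; apply: lt_le_trans (val_add v a b); rewrite lt_min xa xb.
- by move=> i _; rewrite ltNge H.
Qed.
End Val.

Section Trop.
Context (K : fieldType) (r : nat) (G : {fset 'rV[K]_r}).
Implicit Types (B : {set G}) (f : 'I_r -> G).

Definition rows_of f : 'M[K]_r := \matrix_(i < r) fsval (f i).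

Definition set_row (A : 'M[K]_r) (k : 'I_r) (x : 'rV[K]_r) : 'M[K]_r :=
  \matrix_(i < r) (if i == k then x else row i A).

Lemma det_of_rows B f : injective f -> B = [set f i | i : 'I_r]%SET ->
  exists b : bool, \det (rows_of f) = (-1) ^+ b * det_of B.
Proof.
move=> fI BE; have sB : size (enum B) = r.
  by rewrite -cardE BE card_imset // card_ord.
have sB' : size (enum B) == r by apply/eqP.
have st : size [seq f i | i <- enum 'I_r] == r by rewrite size_map size_enum_ord.
have : perm_eq (Tuple st) (Tuple sB').
  apply: uniq_perm => /=.
  - by rewrite map_inj_uniq //; exact: enum_uniq.
  - exact: enum_uniq.
  - move=> x; rewrite mem_enum BE; apply/mapP/imsetP => -[i _ ->]; exists i => //.
    by rewrite mem_enum.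
case/tuple_permP => p pE; exists (odd_perm p).
have fE i : f i = nth (f i) (enum B) (p i).
  transitivity (tnth (Tuple st) i).
    by rewrite (tnth_nth (f i)) /= (nth_map i) ?size_enum_ord // nth_ord_enum.
  rewrite (tnth_nth (f i)) pE /= (nth_map i) ?size_enum_ord // nth_ord_enum.
  by rewrite (tnth_nth (f i)).
rewrite -det_perm -det_mulmx -row_permE; congr (\det _).
apply/matrixP => i j; rewrite !mxE (nth_map (f i)) -?fE //.
by rewrite sB.
Qed.

Lemma basis_rows B : det_of B != 0 -> #|B| = r ->
  exists2 f, \det (rows_of f) != 0 & B = [set f i | i : 'I_r]%SET.
Proof.
move=> dB cB; pose f i := enum_val (cast_ord (esym cB) i).
have fI : injective f by move=> i j /enum_val_inj /cast_ord_inj.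
have BE : B = [set f i | i : 'I_r]%SET.
  apply/setP => x; apply/idP/imsetP => [xB | [i _ ->]]; last exact: enum_valP.
  by exists (cast_ord cB (enum_rank_in xB x)) => //; rewrite /f cast_ordK enum_rankK_in.
exists f => //; have [b ->] := det_of_rows fI BE.
by rewrite mulf_eq0 signr_eq0.
Qed.

Lemma det_inj f : \det (rows_of f) != 0 -> injective f.
Proof.
move=> d i j fij; apply/eqP; apply: contraNT d => ij.
by apply/eqP/(determinant_alternate ij) => k; rewrite !mxE fij.
Qed.

Lemma det_set_row (A : 'M[K]_r) k x :
  \det (set_row A k x) = \sum_j x 0 j * cofactor A k j.
Proof.
rewrite (expand_det_row _ k); apply: eq_bigr => j _.
rewrite !mxE eqxx; congr (_ * (_ * \det _)).
apply/matrixP => a b; rewrite !mxE eq_sym (negbTE (neq_lift _ _)) !mxE //.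
Qed.

Lemma det_set_row_sum (A : 'M[K]_r) k (c : 'I_r -> K) (y : 'I_r -> 'rV[K]_r) :
  \det (set_row A k (\sum_l c l *: y l)) = \sum_l c l * \det (set_row A k (y l)).
Proof.
rewrite det_set_row; under [RHS]eq_bigr do rewrite det_set_row mulr_sumr.
rewrite exchange_big /=; apply: eq_bigr => j _.
rewrite summxE mulr_suml; apply: eq_bigr => l _; by rewrite !mxE mulrA.
Qed.

Lemma det_set_row_row (A : 'M[K]_r) (k l : 'I_r) :
  \det (set_row A k (row l A)) = (l == k)%:R * \det A.
Proof.
case: eqP => [->|/eqP lk]; rewrite ?mul1r ?mul0r.
  congr (\det _); apply/row_matrixP => i; rewrite rowK; by case: eqP => [->|].
apply: (determinant_alternate lk) => j.
by rewrite !mxE (negbTE lk) ?eqxx.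
Qed.

Definition upd f (k : 'I_r) (y : G) : 'I_r -> G := fun i => if i == k then y else f i.

Lemma rows_upd f k y : rows_of (upd f k y) = set_row (rows_of f) k (fsval y).
Proof. by apply/row_matrixP => i; rewrite !rowK /upd; case: eqP => // _; rewrite rowK. Qed.

Lemma upd_imset f k y : injective f ->
  [set upd f k y i | i : 'I_r]%SET = (y |: [set f i | i : 'I_r] :\ f k)%SET.
Proof.
move=> fI; apply/setP => x; rewrite !inE; apply/imsetP/idP => [[i _ ->]|].
  rewrite /upd; case: (i =P k) => [_|/eqP ik]; first by rewrite eqxx.
  by rewrite (inj_eq fI) ik /= imset_f ?orbT.
case/orP => [/eqP ->|/andP[xk /imsetP[i _ xE]]].
  by exists k => //; rewrite /upd eqxx.
exists i => //; rewrite /upd; case: (i =P k) => // ik.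
by move: xk; rewrite xE ik eqxx.
Qed.

Lemma rows_expand f (x : 'rV[K]_r) : \det (rows_of f) != 0 ->
  exists c : 'I_r -> K, x = \sum_l c l *: fsval (f l).
Proof.
move=> d; exists (fun l => (x *m invmx (rows_of f)) 0 l).
have U : rows_of f \in unitmx by rewrite unitmxE unitfE.
rewrite -[LHS](mulmxKV U) mulmx_sum_row; apply: eq_bigr => l _.
by rewrite rowK.
Qed.

Lemma det_upd f (k : 'I_r) (c : 'I_r -> K) (x : G) : fsval x = \sum_l c l *: fsval (f l) ->
  \det (rows_of (upd f k x)) = c k * \det (rows_of f).
Proof.
move=> xE; rewrite rows_upd xE.
rewrite (eq_bigr (fun l => c l *: row l (rows_of f))); last by move=> l _; rewrite rowK.
rewrite det_set_row_sum (bigD1 k) //= det_set_row_row. rewrite eqxx mul1r big1 ?addr0 //.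
by move=> l lk; rewrite det_set_row_row (negbTE lk) mul0r mulr0.
Qed.

Context (R : realType) (v : valuation K R).

Lemma trop_val_rows f : injective f ->
  trop_val v [set f i | i : 'I_r]%SET = v (\det (rows_of f)).
Proof.
move=> fI; rewrite /trop_val card_imset // card_ord eqxx.
by have [b ->] := det_of_rows fI erefl; rewrite valuation_sign.
Qed.

Lemma trop_val_basis B : trop_val v B != +oo%E ->
  exists2 f, \det (rows_of f) != 0 & B = [set f i | i : 'I_r]%SET.
Proof.
rewrite /trop_val; case: (#|B| =P r) => [cB|]; last by rewrite eqxx.
by rewrite val_infty => d; apply: basis_rows.
Qed.

Lemma trop_val_ninfty B : trop_val v B != -oo%E.
Proof. by rewrite /trop_val; case: ifP => // _; apply: val_ninfty. Qed.

Lemma trop_val_exchange B B' : trop_val v B != +oo%E -> trop_val v B' != +oo%E ->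
  forall b, b \in (B :\: B')%SET -> exists2 b', b' \in (B' :\: B)%SET &
    (trop_val v (b' |: B :\ b)%SET + trop_val v (b |: B' :\ b')%SET
       <= trop_val v B + trop_val v B')%E.
Proof.
move=> /trop_val_basis[f df ->] /trop_val_basis[g dg ->] b.
have fI := det_inj df; have gI := det_inj dg.
rewrite inE => /andP[bB' /imsetP[k _ bE]].
have [c cE] := rows_expand (fsval b) dg.
have E : \det (rows_of f) * \det (rows_of g) =
    \sum_l \det (rows_of (upd f k (g l))) * \det (rows_of (upd g l b)).
  under eq_bigr do rewrite (det_upd _ cE) rows_upd mulrCA mulrA.
  rewrite -mulr_suml; congr (_ * _); rewrite -det_set_row_sum -cE bE -rows_upd.
  congr (\det (rows_of _)); apply: funext => i; rewrite /upd.
  by case: eqP => [->|].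
have S0 : \det (rows_of f) * \det (rows_of g) != 0 by rewrite mulf_neq0.
have := S0; rewrite {1}E => /(valuation_sum v)[l]; rewrite -E => le.
have : \det (rows_of (upd f k (g l))) * \det (rows_of (upd g l b)) != 0.
  rewrite -(val_infty v); apply: contraTneq le => ->.
  by rewrite -ltNge ltey val_infty.
rewrite mulf_eq0 negb_or => /andP[d1 d2].
exists (g l).
  rewrite inE imset_f // andbT; apply/imsetP => -[i _ glE].
  have [ik|/eqP ik] := eqVneq i k; first by move: bB'; rewrite bE -ik -glE imset_f.
  have /(_ i k) := det_inj d1; rewrite /upd eqxx; case: eqP => // _ /(_ (esym glE)).
  by [].
rewrite {1}bE -!upd_imset // !trop_val_rows //; try exact: det_inj.
by rewrite -!val_mul.
Qed.

Lemma exists_basis : <<G>>%VS = fullv -> exists B, trop_val v B != +oo%E.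
Proof.
move=> GT; pose A : 'M[K]_(#|{: G}|, r) := \matrix_(i < #|{: G}|) fsval (enum_val i).
have AF : row_full A.
  rewrite -sub1mx; apply/row_subP => i; set x := row i _.
  pose U := limg (linfun (mulmxr A : 'rV[K]_#|{: G}| -> 'rV[K]_r)).
  suff /memv_imgP[y _ ->] : x \in U by rewrite lfunE /= submxMl.
  suff /subvP sub : (<<G>> <= U)%VS by apply: sub; rewrite GT memvf.
  apply/span_subvP => z zG; apply/memv_imgP.
  exists (delta_mx 0 (enum_rank [` zG]%fset)); rewrite ?memvf //.
  by rewrite lfunE /= -rowE rowK enum_rankK.
pose f (i : 'I_r) : G := enum_val (fullrankfun AF i).
have d : \det (rows_of f) != 0.
  rewrite -unitfE -unitmxE; suff -> : rows_of f = rowsub (fullrankfun AF) A.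
    exact: fullrowsub_unit.
  by apply/matrixP => i j; rewrite !mxE.
exists [set f i | i : 'I_r]%SET; rewrite trop_val_rows ?val_infty //.
exact: det_inj.
Qed.

Definition trop_matroid (GT : <<G>>%VS = fullv) : valuated_matroid R G :=
  ValuatedMatroid trop_val_ninfty (exists_basis GT) trop_val_exchange.

Lemma trop_matroid_flat (GT : <<G>>%VS = fullv) (V : {vspace 'rV[K]_r}) :
  vm_flat (trop_matroid GT) [set w : G | fsval w \in V]%SET.
Proof.
set A := [set w : G | _]%SET; apply/forallP => x; apply/implyP => xA.
have xV : fsval x \notin V by move: xA; rewrite inE.
have [B0 B0P] := exists_basis GT.
rewrite {1}/vm_rank (bigop.bigmax_eq_arg B0) //; case: arg_maxnP => //= B BP _.
have [f df BE] := trop_val_basis BP; have fI := det_inj df.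
suff [B' B'P lt] : exists2 B', trop_val v B' != +oo%E &
    (#|A :&: B| < #|(x |: A) :&: B'|)%SET%N.
  by apply: leq_trans lt _; apply: (leq_bigmax_cond B').
have [xB|xB] := boolP (x \in B).
  exists B => //; apply: proper_card; apply/properP; split.
    by apply: finset.setSI; apply: finset.subsetUr.
  by exists x; rewrite !inE ?eqxx ?xB ?(negbTE xV).
have [c cE] := rows_expand (fsval x) df.
have [k ck kV] : exists2 k, c k != 0 & f k \notin A.
  apply: contrapT => H; move: xV; rewrite cE => /negP; apply.
  apply: memv_suml => l _; have [->|c0] := eqVneq (c l) 0; first by rewrite scale0r mem0v.
  apply: memvZ; apply: contrapT => fl; apply: H; exists l => //.
  by rewrite inE; apply/negP.
have d' : \det (rows_of (upd f k x)) != 0 by rewrite (det_upd _ cE) mulf_neq0.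
exists (x |: B :\ f k)%SET.
  by rewrite BE -upd_imset // trop_val_rows ?val_infty //; apply: det_inj.
apply: proper_card; apply/properP; split; last first.
  by exists x; rewrite !inE ?eqxx ?xB ?(negbTE xV).
apply/fintype.subsetP => y; rewrite [in X in X -> _]inE => /andP[yA yB].
move: yA; rewrite !inE => yV; rewrite yV yB orbT andbT /=.
by apply/orP; right; apply: contraNneq kV => <-; rewrite inE.
Qed.
End Trop.

Section TropBundle.
Context (K : fieldType) (R : realType) (v : valuation K R) (n s r : nat).
Context (S : fan R n s) (F : toric_bundle K r S) (G : {fset 'rV[K]_r}).
Context (rG : realization F G).

Lemma trop_flatP i j : vm_flat (trop_matroid v (rlz_span rG)) (trop_flat F G i j).
Proof. exact: trop_matroid_flat. Qed.

Lemma trop_flat_decr i j k : j <= k -> trop_flat F G i k \subset trop_flat F G i j.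
Proof.
move=> jk; apply/fintype.subsetP => w; rewrite !inE.
by apply/subvP; apply: filt_decr.
Qed.

Lemma trop_flat_full i : exists j0, forall j, j <= j0 ->
  trop_flat F G i j = [set: G]%SET.
Proof.
have [j0 H] := filt_full F i; exists j0 => j /H E.
by apply/setP => w; rewrite !inE E memvf.
Qed.

Lemma trop_flat_empty i : exists j0, forall j, j0 <= j ->
  trop_flat F G i j = finset.set0.
Proof.
have [j0 H] := filt_zero F i; exists j0 => j /H E.
apply/setP => w; rewrite !inE E memv0; apply: contraNF (rlz_neq0 rG) => /eqP <-.
exact: fsvalP.
Qed.

Definition tropicalization : trop_bundle R s G :=
  TropBundle trop_flatP trop_flat_decr trop_flat_full trop_flat_empty.

End TropBundle.

(* Main.v *)
(** Over the torus a section is a Laurent polynomial with coefficients in [E];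
    it extends over [U_sigma] iff its coefficient at each [m] lies in every
    [E^i(-m.v_i)] with [rho_i] in [sigma], because the filtrations of [sigma]
    are split by one common decomposition.  Hence the [u]-component of [H^0] is
    the intersection [W_u] of all the [E^i(u.v_i)], an element of [L'(F)].  On
    the tropical side [u] lies in [P_w] iff [w] lies in [W_u], and [W_u] is
    spanned by its elements in [G], so the rank in question is [dim W_u].
    Finally [W_u] is nonzero only if the [u.v_i] are bounded above, which by
    completeness of the fan confines [u] to a bounded region. *)
Require Import Defs.
From mathcomp Require Import all_boot all_order all_algebra finmap.
From mathcomp Require Import all_classical reals constructive_ereal.
From mathcomp Require Import zify.

Set Implicit Arguments.
Unset Strict Implicit.
Unset Printing Implicit Defensive.

Import Order.TTheory GRing.Theory Num.Theory.

Local Open Scope ring_scope.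

(** * Linear algebra: split families of subspaces, and spaces of finitely supported functions *)

Section LinearAlgebra.
Context (K : fieldType).

Lemma memv_bigcapP (V : vectType K) (J : finType) (P : pred J)
    (W : J -> {vspace V}) x :
  reflect (forall j, P j -> x \in W j) (x \in (\bigcap_(j | P j) W j)%VS).
Proof.
by rewrite memvE; apply: (iffP subv_bigcapP) => H j Pj; have := H j Pj; rewrite -memvE.
Qed.

(** Components along a direct sum are unique, so lying in the [j]-th partial sum forces every
    component outside [P j] to vanish. Intersections of arbitrary subspaces do not distribute over
    sums; the common splitting is what makes it work. *)
Lemma bigcap_directv_sum (V : vectType K) (I J : finType) (D : I -> {vspace V})
    (Q : pred J) (P : J -> pred I) :
    directv (\sum_i D i) -> (\sum_i D i)%VS = fullv ->
  (\bigcap_(j | Q j) \sum_(i | P j i) D i)%VS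
    = (\sum_(i | [forall j, Q j ==> P j i]) D i)%VS.
Proof.
move=> dD fD; apply/eqP; rewrite eqEsubv; apply/andP; split; last first.
  apply/subv_bigcapP => j Qj; apply/subv_sumP => i /forallP/(_ j)/implyP/(_ Qj) Pji.
  exact: sumv_sup Pji (subvv _).
apply/subvP => x /memv_bigcapP xI.
have /memv_sumP[y yD xE] : x \in (\sum_i D i)%VS by rewrite fD memvf.
rewrite xE (bigID (fun i => [forall j, Q j ==> P j i])) /= [X in _ + X]big1 ?addr0.
  by apply: memv_suml => i Pi; rewrite memvE; apply: sumv_sup Pi _; rewrite -memvE yD.
move=> i; rewrite negb_forall => /existsP[j]; rewrite negb_imply => /andP[Qj nP].
have /memv_sumP[z zD xE'] := xI j Qj.
(* Extension by zero makes both decompositions of [x] run over all of [I], so that uniqueness can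
   compare them. *)
pose z' i := if P j i then z i else 0.
have E : \sum_i y i == \sum_i z' i by rewrite -xE xE' big_mkcond.
have z'D k : true -> z' k \in D k.
  by move=> _; rewrite /z'; case: ifP => [/zD //|_]; rewrite mem0v.
have := directv_sum_unique dD y z' yD z'D; rewrite E => /esym/forall_inP/(_ i isT)/eqP ->.
by rewrite /z' (negbTE nP).
Qed.

Lemma lin_span_mem (V : lmodType K) (A : set V) x : A x -> lin_span A x.
Proof.
move=> Ax; exists [:: (1, x)]; split; last by rewrite big_seq1 scale1r.
by move=> p; rewrite inE => /eqP ->.
Qed.

Lemma lin_span_sum (V : lmodType K) (A : set V) (I : Type) (l : seq I)
    (P : pred I) (x : I -> V) :
  (forall i, P i -> lin_span A (x i)) -> lin_span A (\sum_(i <- l | P i) x i).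
Proof.
move=> H; apply: (big_ind (lin_span A)) => //.
  by exists [::]; split => //; rewrite big_nil.
move=> y z [l1 [H1 ->]] [l2 [H2 ->]]; exists (l1 ++ l2); split; last by rewrite big_cat.
by move=> p; rewrite mem_cat => /orP[/H1|/H2].
Qed.

(** Common model for [H0] and [H0_wt]: coefficient functions with prescribed value spaces and
    support in a list. *)
Definition fun_space (T : eqType) (V : vectType K) (W : T -> {vspace V}) (l : seq T)
  : set (T -> V) := [set f | forall t, f t \in W t /\ (t \notin l -> f t = 0)].

(** Induction on [l]: a basis for [t :: l] joins the basis of [W t], placed at [t], to a basis for
    [l]. The latter functions vanish at [t] because [l] has no repetitions, so evaluation at [t]
    separates the two blocks. *)
Lemma has_dim_fun_space (T : eqType) (V : vectType K) (W : T -> {vspace V}) (l : seq T) :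
  uniq l -> has_dim (fun_space W l) (\sum_(t <- l) \dim (W t))%N.
Proof.
elim: l => [_|t l IH /= /andP[tl /IH [b [bW bI bG]]]].
  rewrite big_nil; exists (fun _ => 0); split.
  - by case.
  - by move=> c _ [].
  - move=> f fW; exists (fun _ => 0); rewrite big_ord0.
    by apply/funext => t; case: (fW t) => _ ->.
rewrite big_cons.
pose a (i : 'I_(\dim (W t))) : T -> V := fun t' => if t' == t then (vbasis (W t))`_i else 0.
have aE i t' : a i t' = if t' == t then (vbasis (W t))`_i else 0 by [].
have bt j : b j t = 0 by case: (bW j t) => _ ->.
exists (fun i => match fintype.split i with inl i => a i | inr j => b j end).
have sumE c : \sum_i c i *: match fintype.split i with inl i => a i | inr j => b j end =
    \sum_i c (lshift _ i) *: a i + \sum_j c (rshift _ j) *: b j.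
  rewrite big_split_ord; congr (_ + _); apply: eq_bigr => i _.
    case: fintype.splitP => j /= E; first by congr (_ *: a _); apply/val_inj.
    by move: (ltn_ord i); rewrite E ltnNge leq_addr.
  case: fintype.splitP => j /= E; first by move: (ltn_ord j); rewrite -E ltnNge leq_addr.
  by congr (_ *: b _); apply/val_inj; move/addnI: E.
have bt0 (d : 'I__ -> K) : (\sum_j d j *: b j) t = 0.
  by rewrite fct_sumE big1 // => j _; rewrite /GRing.scale /= bt scaler0.
have at0 (d : 'I__ -> K) : (\sum_i d i *: a i) t = \sum_i d i *: (vbasis (W t))`_i.
  by rewrite fct_sumE; apply: eq_bigr => i _; rewrite /GRing.scale /= aE eqxx.
have at1 (d : 'I__ -> K) t' : t' != t -> (\sum_i d i *: a i) t' = 0.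
  move=> tt'; rewrite fct_sumE big1 // => i _.
  by rewrite /GRing.scale /= aE (negbTE tt') scaler0.
split.
- move=> i t'; case: (fintype.split i) => {i} j.
    rewrite aE inE negb_or; case: eqP => [->|_]; last by rewrite mem0v.
    by split => //; apply: vbasis_mem; rewrite mem_nth ?size_tuple.
  by have [? H] := bW j t'; split=> //; rewrite inE negb_or => /andP[_ /H].
- move=> c; rewrite sumE => E.
  have cl i : c (lshift _ i) = 0.
    have /(congr1 (fun f => f t)) := E; rewrite /GRing.add /= at0 bt0 addr0.
    move=> E'; have /freeP/(_ (fun i => c (lshift _ i)) E') := basis_free (vbasisP (W t)).
    by apply.
  have cr j : c (rshift _ j) = 0.
    apply: (bI (fun j => c (rshift _ j))); rewrite -[RHS]E [X in _ = X + _]big1 ?add0r // => i _.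
    by rewrite cl scale0r.
  by move=> i; rewrite -(fintype.splitK i); case: (fintype.split i) => j /=; rewrite ?cl ?cr.
- move=> f fW.
  have [ft _] := fW t.
  (* With its value at [t] erased, [f] belongs to the space for [l]; the erased value is expanded in
     [vbasis (W t)]. *)
  have [t'|d dE] := bG (fun t' => if t' == t then 0 else f t').
    case: eqP => [->|/eqP tt']; first by rewrite mem0v.
    have [? H] := fW t'; split => // nl; apply: H.
    by rewrite inE negb_or tt'.
  exists (fun i => match fintype.split i with
                   | inl i => coord (vbasis (W t)) i (f t) | inr j => d j end).
  rewrite sumE; under [X in _ = X + _]eq_bigr do rewrite (unsplitK (inl _)).
  under [X in _ = _ + X]eq_bigr do rewrite (unsplitK (inr _)).
  apply/funext => t'; rewrite -dE /GRing.add /=.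
  by case: eqP => [->|/eqP tt']; rewrite ?at0 ?addr0 -?coord_vbasis // at1 // add0r.
Qed.

End LinearAlgebra.

(** * Sections of the bundle and their weight spaces *)

Section Sections.
Context (K : fieldType) (R : realType) (n s r : nat).
Context (S : fan R n s) (F : toric_bundle K r S).

Definition wt_space (u : 'rV[int]_n) : {vspace 'rV[K]_r} :=
  (\bigcap_i filt F i (dot u (ray S i)))%VS.

Lemma dotDl (A : nzRingType) m (u v w : 'rV[A]_m) : dot (u + v) w = dot u w + dot v w.
Proof. by rewrite -big_split; apply: eq_bigr => k _; rewrite mxE mulrDl. Qed.

Lemma dotNl (A : nzRingType) m (u w : 'rV[A]_m) : dot (- u) w = - dot u w.
Proof. by rewrite -sumrN; apply: eq_bigr => k _; rewrite mxE mulNr. Qed.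

Lemma dot_real_pt (u v : 'rV[int]_n) :
  dot (real_pt R u) (real_pt R v) = (dot u v)%:~R.
Proof. by rewrite rmorph_sum; apply: eq_bigr => k _; rewrite !mxE rmorphM. Qed.

Lemma klyachko_bigcap (sigma : {set 'I_s}) D (k : 'I_s -> int) x :
    klyachko_splitting S (filt F) sigma D ->
    (forall i, i \in sigma -> x \in filt F i (k i)) ->
  exists (U : {fset 'rV[int]_n}) (y : U -> 'rV[K]_r), x = \sum_a y a /\
    forall a : U, y a \in D (val a) /\
      (y a = 0 \/ forall i, i \in sigma -> k i <= dot (val a) (ray S i)).
Proof.
case=> U [_ dD fD fE] xk; exists U.
have dD' : directv (\sum_(a : U) D (val a)).
  by move: dD; rewrite !directvE /= !big_seq_fsetE.
have fD' : (\sum_(a : U) D (val a))%VS = fullv by rewrite -fD big_seq_fsetE.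
have : x \in (\bigcap_(i in sigma)
    \sum_(a : U | (k i <= dot (val a) (ray S i))%R) D (val a))%VS.
  apply/memv_bigcapP => i si.
  by have := xk i si; rewrite (fE i si) big_seq_fsetE.
rewrite (bigcap_directv_sum _
  (fun i (a : U) => (k i <= dot (val a) (ray S i))%R) dD' fD').
case/memv_sumP => y yD xE.
exists (fun a =>
  if [forall j in sigma, (k j <= dot (val a) (ray S j))%R] then y a else 0).
split; first by rewrite -big_mkcond.
move=> a; case: ifP => [H|_]; last by rewrite mem0v; split=> //; left.
by split; [apply: yD | right => i si; have /forallP/(_ i)/implyP := H; apply].
Qed.

Lemma klyachko_mem (sigma : {set 'I_s}) D u e i :
    klyachko_splitting S (filt F) sigma D -> e \in D u -> i \in sigma ->
  e \in filt F i (dot u (ray S i)).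
Proof.
case=> U [D0 _ _ fE] eD si; rewrite (fE i si) big_seq_fsetE.
have [uU|/D0 Du] := boolP (u \in U); last first.
  by move: eD; rewrite Du memv0 => /eqP ->; rewrite mem0v.
by rewrite memvE; apply: (sumv_sup [` uU]%fset) => //; rewrite -memvE.
Qed.

(** A generator has exponent [m - u], and [(u - m).v_i <= u.v_i] on [sigma], so its coefficient lies
    in the required steps since filtrations decrease. Conversely each coefficient is split by
    [klyachko_bigcap], and every component yields a generator. Finite support reflects that
    [lin_span] takes finite combinations. *)
Lemma chart_sectionsP (sigma : {set 'I_s}) f : sigma \in cones S ->
  chart_sections F sigma f <->
  (exists T : {fset 'rV[int]_n}, forall m, m \notin T -> f m = 0) /\
  (forall m i, i \in sigma -> f m \in filt F i (dot (- m) (ray S i))).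
Proof.
move=> sS; split.
  case=> D DS [l [lA ->]]; rewrite big_seq.
  pose P (g : 'rV[int]_n -> 'rV[K]_r) :=
    (exists T : {fset 'rV[int]_n}, forall m, m \notin T -> g m = 0) /\
    (forall m i, i \in sigma -> g m \in filt F i (dot (- m) (ray S i))).
  apply: (big_ind P).
  - by split; [exists fset0 | move=> *; rewrite mem0v].
  - move=> g1 g2 [[T1 H1] W1] [[T2 H2] W2]; split.
      exists (T1 `|` T2)%fset => m; rewrite in_fsetU negb_or => /andP[/H1 E1 /H2 E2].
      by rewrite /GRing.add /= E1 E2 addr0.
    by move=> m i si; apply: memvD; [apply: W1 | apply: W2].
  move=> p /lA[e [m [u [eD mS ->]]]]; split.
    exists [fset m - u]%fset => m'; rewrite in_fset1 => /negbTE mm.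
    by rewrite /GRing.scale /= /lmono mm scaler0.
  move=> m' i si; apply: memvZ; rewrite /lmono; case: eqP => [->|_]; last by rewrite mem0v.
  apply: (subvP (filt_decr F i _)) (klyachko_mem DS eD si).
  by rewrite opprB dotDl dotNl lerBlDr lerDl mS.
case=> -[T fT] fW; have [D DS] := filt_split F sS; exists D => //.
have -> : f = \sum_(m <- T) lmono (f m) m.
  apply/funext => m; rewrite fct_sumE.
  have [mT|mT] := boolP (m \in T).
    rewrite (big_fsetD1 m) //= /lmono eqxx big1_fset ?addr0 // => m'.
    by rewrite in_fsetD1 eq_sym => /andP[/negbTE ->].
  rewrite fT // big1_fset // => m' m'T _.
  by rewrite /lmono; case: eqP m'T mT => [->|//] ->.
apply: lin_span_sum => m _.
have [U [y [-> yP]]] := klyachko_bigcap DS (fW m).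
have -> : lmono (\sum_a y a) m = \sum_a lmono (y a) m.
  apply/funext => m'; rewrite fct_sumE /lmono; case: eqP => //.
  by rewrite big1.
apply: lin_span_sum => a _.
have [yD [->|H]] := yP a.
  have -> : lmono 0 m = 0 :> ('rV[int]_n -> 'rV[K]_r).
    by apply/funext => m'; rewrite /lmono; case: eqP.
  by exists [::]; rewrite big_nil.
(* The exponent [m] is written as [(m + val a) - val a]; the inequality [H] says exactly that
   [m + val a] is nonnegative on [sigma]. *)
apply: lin_span_mem; exists (y a), (m + val a), (val a); split => //; last by rewrite addrK.
by move=> i /H; rewrite dotDl dotNl lerNl -subr_ge0 opprK addrC.
Qed.

(** The chart conditions only constrain one ray at a time, so the one-ray cones already impose all
    of them; the zero cone provides finite support even if there are no rays. *)
Lemma H0P f : H0 F f <->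
  (exists T : {fset 'rV[int]_n}, forall m, m \notin T -> f m = 0) /\
  (forall m, f m \in wt_space (- m)).
Proof.
split=> [H|[fT fW] sigma sS].
  split; first by have /(chart_sectionsP _ (fan_zero S))[] := H _ (fan_zero S).
  move=> m; apply/memv_bigcapP => i _.
  have /(chart_sectionsP _ (fan_ray S i))[_] := H _ (fan_ray S i).
  by apply; rewrite inE.
apply/chart_sectionsP => //; split=> // m i _.
by have /memv_bigcapP/(_ i isT) := fW m.
Qed.

Lemma H0_wt_dim u : has_dim (H0_wt F u) (\dim (wt_space u)).
Proof.
have := @has_dim_fun_space K _ _ (fun m => wt_space (- m)) [:: - u] isT.
rewrite big_seq1 opprK; congr (has_dim _ _); apply/seteqP; split=> f.
  move=> H; split; last by move=> m mu; case: (H m) => _; apply; rewrite inE.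
  apply/H0P; split; last by move=> m; case: (H m).
  exists [fset - u]%fset => m mu; case: (H m) => _; apply.
  by move: mu; rewrite in_fset1 inE.
case=> /H0P[_ fW] f0 m; split=> //.
by rewrite inE; apply: f0.
Qed.

Lemma H0_dim (l : seq 'rV[int]_n) : uniq l ->
    (forall u, u \notin l -> wt_space u = 0%VS) ->
  has_dim (H0 F) (\sum_(u <- l) \dim (wt_space u))%N.
Proof.
move=> ul l0; have ul' : uniq (map -%R l) by rewrite (map_inj_uniq oppr_inj).
have := has_dim_fun_space (fun m => wt_space (- m)) ul'.
rewrite big_map; under eq_bigr do rewrite opprK.
congr (has_dim _ _); apply/seteqP; split=> f.
  move=> H; apply/H0P; split; last by move=> m; case: (H m).
  exists [fset m in map -%R l]%fset => m ml; case: (H m) => _; apply.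
  by move: ml; rewrite inE.
case/H0P=> _ fW m; split=> // ml; apply/eqP; rewrite -memv0 -(l0 (- m)) //.
by apply: contra ml => ?; rewrite -(opprK m) map_f.
Qed.

(** * Finiteness of the set of weights *)

Lemma finite_int_box (N : nat) :
  finite_set [set u : 'rV[int]_n | forall k, `|u 0 k| <= N%:Z]%classic.
Proof.
pose g (M : 'rV['I_(N + N).+1]_n) : 'rV[int]_n :=
  map_mx (fun i : 'I_(N + N).+1 => i%:Z - N%:Z) M.
apply: (@sub_finite_set _ _ (g @` setT)%classic); last exact:
  finite_image (@finite_finset 'rV['I_(N + N).+1]_n setT).
move=> u uN; exists (\row_k inord (absz (u 0 k + N%:Z))) => //.
apply/rowP => k; rewrite !mxE.
have := uN k; rewrite ler_norml => /andP[l1 l2].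
by rewrite inordK; lia.
Qed.

(** Each filtration vanishes from some step on, which bounds every [u.v_i] above. By completeness
    any [x] is a nonnegative combination of rays, so [u.x] is bounded above too; taking [x] to be
    plus or minus a unit vector bounds each coordinate of [u]. *)
Lemma wt_space_finite : complete_fan S ->
  finite_set [set u | wt_space u != 0%VS]%classic.
Proof.
move=> cS.
have [b bP] : exists b : 'I_s -> int, forall u, wt_space u != 0%VS ->
    forall i, dot u (ray S i) <= b i.
  have /choice[b bP] : forall i, exists j0, forall j, j0 <= j -> filt F i j = 0%VS.
    exact: filt_zero.
  exists b => u u0 i; rewrite leNgt; apply: contra u0 => /ltW/bP Ei.
  by rewrite -subv0 -Ei; apply: bigcapv_inf (subvv _).
have bound (x : 'rV[R]_n) : exists C : R, forall u, wt_space u != 0%VS ->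
    dot (real_pt R u) x <= C.
  have [sigma _ [c [c0 ->]]] := cS x.
  exists (\sum_(i in sigma) c i * (b i)%:~R) => u /bP ub.
  have -> : dot (real_pt R u) (\sum_(i in sigma) c i *: real_pt R (ray S i)) =
      \sum_(i in sigma) c i * (dot u (ray S i))%:~R.
    under [RHS]eq_bigr do rewrite -dot_real_pt mulr_sumr.
    rewrite exchange_big; apply: eq_bigr => k _.
    by rewrite summxE mulr_sumr; apply: eq_bigr => i _; rewrite !mxE mulrCA.
  by apply: ler_sum => i _; rewrite ler_wpM2l // ler_int.
have dot_delta (u : 'rV[int]_n) (e : R) k :
    dot (real_pt R u) (e *: delta_mx 0 k) = e * (u 0 k)%:~R.
  rewrite /dot (bigD1 k) //= big1 ?addr0 => [|l lk].
    by rewrite !mxE !eqxx mulr1 mulrC.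
  by rewrite !mxE (negbTE lk) andbF !mulr0.
have /choice[N NP] : forall k, exists N : nat, forall u,
    wt_space u != 0%VS -> `|u 0 k| <= N%:Z.
  move=> k; have [C1 H1] := bound (1 *: delta_mx 0 k).
  have [C2 H2] := bound (-1 *: delta_mx 0 k).
  exists (Num.truncn (Num.max `|C1| `|C2|)).+1 => u u0.
  have : (`|u 0 k|%:~R : R) <= Num.max `|C1| `|C2|.
    rewrite intr_norm ler_norml; apply/andP; split.
      rewrite lerNl le_max; apply/orP; right.
      by have := H2 u u0; rewrite dot_delta mulN1r => /le_trans; apply; apply: ler_norm.
    rewrite le_max; apply/orP; left.
    by have := H1 u u0; rewrite dot_delta mul1r => /le_trans; apply; apply: ler_norm.
  move=> le; rewrite -(ler_int R); apply: le_trans le _; apply/ltW.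
  exact: Num.Theory.truncnS_gt.
apply: sub_finite_set (finite_int_box (\max_k N k)) => u u0 k /=.
by apply: le_trans (NP k u u0) _; rewrite lez_nat; apply: leq_bigmax.
Qed.

End Sections.

(** * The tropical side: ranks, closures and polytopes *)

(** For a basis [B] meeting [A] in as many elements as possible, [A :&: B] spans [V]: otherwise an
    exchange would enlarge the intersection. Being free as well, it has [\dim V] elements. *)
Lemma trop_matroid_rank (K : fieldType) (R : realType) (v : valuation K R) (r : nat)
    (G : {fset 'rV[K]_r}) (GT : <<G>>%VS = fullv) (V : {vspace 'rV[K]_r}) :
    V = <<[seq w <- G | w \in V]>>%VS ->
  vm_rank (trop_matroid v GT) [set w : G | fsval w \in V]%SET = \dim V.
Proof.
move=> VE; set A := [set w : G | _]%SET.
have [B0 B0P] := exists_basis v GT.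
rewrite /vm_rank (bigop.bigmax_eq_arg B0) //; case: arg_maxnP => //= B BP Bmax.
have [f df BE] := trop_val_basis BP; have fI := det_inj df.
pose X := [seq fsval (f l) | l <- enum 'I_r].
have sX : size X == r by rewrite size_map size_enum_ord.
have XE (l : 'I_r) : X`_l = fsval (f l).
  by rewrite (nth_map l) ?size_enum_ord // nth_ord_enum.
have Xfree : free X.
  have -> : X = tval (Tuple sX) by [].
  apply/freeP => k /= E.
  have U : rows_of f \in unitmx by rewrite unitmxE unitfE.
  have : (\row_l k l) *m rows_of f = 0.
    rewrite -[RHS]E mulmx_sum_row; apply: eq_bigr => l _.
    by rewrite rowK mxE XE.
  move/(congr1 (mulmx^~ (invmx (rows_of f)))); rewrite mulmxK // mul0mx => /rowP H l.
  by have := H l; rewrite !mxE.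
pose Y := [seq x <- X | x \in V].
have YV : <<Y>>%VS = V.
  apply/eqP; rewrite eqEsubv; apply/andP; split.
    by apply/span_subvP => x; rewrite mem_filter => /andP[].
  rewrite {1}VE; apply/span_subvP => x; rewrite mem_filter => /andP[xV xG].
  have memY l : f l \in A -> fsval (f l) \in <<Y>>%VS.
    rewrite inE => fV; apply: memv_span; rewrite mem_filter fV.
    by apply/mapP; exists l; rewrite ?mem_enum.
  pose x' := [` xG]%fset; have xA : x' \in A by rewrite inE.
  have [|xB] := boolP (x' \in B).
    rewrite BE => /imsetP[l _ xE].
    have -> : x = fsval (f l) by rewrite -xE.
    by apply: memY; rewrite -xE.
  have [c cE] := rows_expand (fsval x') df.
  rewrite -[x]/(fsval x') cE; apply: memv_suml => k _.
  have [->|ck] := eqVneq (c k) 0; first by rewrite scale0r mem0v.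
  apply: memvZ; apply: memY; apply: contraT => kA.
  (* If [f k], which occurs in the expansion of [x'], were outside [V], replacing it by [x'] would
     give a basis with a larger trace on [A], contradicting [Bmax]. *)
  have d' : \det (rows_of (upd f k x')) != 0 by rewrite (det_upd _ cE) mulf_neq0.
  have B'P : trop_val v (x' |: B :\ f k)%SET != +oo%E.
    by rewrite BE -upd_imset // trop_val_rows ?val_infty //; apply: det_inj.
  have := Bmax _ B'P; rewrite leqNgt => /negP[].
  apply: proper_card; apply/properP; split; last first.
    by exists x'; rewrite !inE ?eqxx ?(negbTE xB) ?andbF ?xV.
  apply/fintype.subsetP => y; rewrite !inE => /andP[yV yB]; rewrite yV yB andbT /=.
  by apply/orP; right; apply: contraNneq kA => <-; rewrite inE.
have /eqP := filter_free (fun x => x \in V) Xfree.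
rewrite -/Y YV => ->; rewrite size_filter count_map.
have -> : (A :&: B = [set f l | l in [set l : 'I_r | fsval (f l) \in V]])%SET.
  apply/setP => x; rewrite !inE BE; apply/andP/imsetP.
    by case=> xV /imsetP[l _ xE]; exists l => //; rewrite inE -xE.
  by case=> l; rewrite inE => lV ->; rewrite lV imset_f.
by rewrite card_imset // cardsE cardE -size_filter enumT.
Qed.

Lemma vm_closure_flat (R : realType) (T : finType) (N : valuated_matroid R T)
    (A : {set T}) : vm_flat N A -> vm_closure N A = A.
Proof.
move=> AF; apply/eqP; rewrite finset.eqEsubset; apply/andP; split.
  by apply: finset.bigcap_inf; rewrite AF /=.
by apply/finset.bigcapsP => C /andP[].
Qed.

(** The flats decrease from everything to nothing, so the maximum in [dvec] is attained and the
    default of [xget] never occurs. This turns the inequalities of [polytope] into membership in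
    flats. *)
Lemma le_dvec (R : realType) (s : nat) (T : finType) (B : trop_bundle R s T)
    (w : T) (i : 'I_s) (j : int) : (j <= dvec B w i) = (w \in tb_flat B i j).
Proof.
suff [d [dB dmax]] : exists d, w \in tb_flat B i d /\
    forall j, w \in tb_flat B i j -> j <= d.
  have [] : [set d | w \in tb_flat B i d /\
      forall j, w \in tb_flat B i j -> j <= d]%classic (dvec B w i).
    by apply: (@xgetPex _ 0); exists d.
  move=> vB vmax; apply/idP/idP => [jd|/vmax//].
  exact: (fintype.subsetP (tb_decr B i jd)).
have [a aP] := tb_full B i; have [b bP] := tb_empty B i.
have lt_b j' : w \in tb_flat B i j' -> j' < b.
  by move=> wj; rewrite ltNge; apply: contraL wj => /bP ->; rewrite inE.
(* Steps are counted from [a], where the flat is everything, so that the search is over naturals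
   bounded by [b - a]. *)
have ex : exists k : nat, w \in tb_flat B i (a + k%:Z).
  by exists 0%N; rewrite addr0 aP ?inE.
have bd (k : nat) : w \in tb_flat B i (a + k%:Z) -> (k <= `|b - a|)%N.
  by move/lt_b; lia.
case: (ex_maxnP ex bd) => k kB kmax; exists (a + k%:Z); split => // j' jB.
have [ja|ja] := leP j' a; first lia.
have jE : a + `|j' - a|%N%:Z = j' by lia.
by have := kmax `|j' - a|%N; rewrite jE => /(_ jB); lia.
Qed.

(** The vectors [w] with [u] in their polytope are those of [G] in [wt_space F u]. They form a flat,
    so closure changes nothing, and they span that space because it belongs to [L'(F)]. *)
Lemma trop_h0_wtE (K : fieldType) (R : realType) (v : valuation K R)
    (n s r : nat) (S : fan R n s) (F : toric_bundle K r S)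
    (G : {fset 'rV[K]_r}) (rG : realization F G) (u : 'rV[int]_n) :
  trop_h0_wt S (tropicalization v rG) u = \dim (wt_space F u).
Proof.
rewrite /trop_h0_wt.
have -> : [set w | real_pt R u \in polytope S (tropicalization v rG) w]%SET
    = [set w : G | fsval w \in wt_space F u]%SET.
  apply/setP => w; rewrite !inE; apply/idP/memv_bigcapP.
    move=> /set_mem H i _; have := H i; rewrite dot_real_pt ler_int le_dvec.
    by rewrite inE.
  move=> H; apply/mem_set => i; rewrite dot_real_pt ler_int le_dvec.
  by rewrite inE; apply: H.
rewrite vm_closure_flat; last exact: trop_matroid_flat.
apply: trop_matroid_rank; apply: (rlz_L rG).
exists [:: wt_space F u]; split; last by rewrite big_seq1.
by move=> W; rewrite inE => /eqP ->; exists (fun i => dot u (ray S i)).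
Qed.

Theorem lemma6p15 (K : fieldType) (R : realType) (v : valuation K R)
    (n s r : nat) (S : fan R n s) (S_smooth : smooth_fan S)
    (S_complete : complete_fan S) (F : toric_bundle K r S)
    (G : {fset 'rV[K]_r}) (rG : realization F G) :
  let E := tropicalization v rG in
  (forall u : 'rV[int]_n, has_dim (H0_wt F u) (trop_h0_wt S E u)) /\
  finite_set [set u : 'rV[int]_n | trop_h0_wt S E u != 0%N]%classic /\
  has_dim (H0 F) (trop_h0 S E).
Proof.
move=> E; have hE : trop_h0_wt S E = fun u => \dim (wt_space F u).
  by apply/funext => u; apply: trop_h0_wtE.
rewrite /trop_h0 hE.
(* Finite support ensures that [trop_h0] is the genuine sum and not the conventional value 0. *)
have fin : finite_set [set u | \dim (wt_space F u) != 0%N]%classic.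
  have := wt_space_finite F S_complete; congr finite_set.
  by apply/seteqP; split=> u /=; rewrite dimv_eq0.
split; first exact: H0_wt_dim.
split=> //; apply: H0_dim => [|u]; first exact: finite_support_uniq.
have finT : finite_set ([set: 'rV[int]_n] `&`
    (fun u => \dim (wt_space F u)) @^-1` [set~ 0%N])%classic.
  by apply: sub_finite_set fin => u' [_ /eqP].
rewrite in_finite_support // => uN; apply/eqP; rewrite -dimv_eq0.
by apply: contraNT uN => u0; apply/mem_set; split => //; apply/eqP.
Qed.
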